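(* Suppose that $G$ is a cycle graph or a complete graph, with vertex set $\{v_1,\ldots,v_n\}$, and let $\mathcal{H}=(H^1,H^2,\ldots,H^n)$ be a sequence of connected graphs. Then $$\dim_{\mathrm{diam}}(G\odot\mathcal{H})=|D(G\odot\mathcal{H})|.$$
   Context: Distances are shortest-path distances: $d_G(u,v)$ is the length of a shortest $u$–$v$ path in the connected graph $G$. The eccentricity of $v$ is $e_G(v)=\max_{u\in V(G)}d_G(u,v)$ and $\operatorname{diam}(G)=\max_v e_G(v)$. A vertex is diametral if its eccentricity equals $\operatorname{diam}(G)$; the diametral set $D(G)$ is the set of all diametral vertices of $G$. For an ordered set $W=\{w_1,\ldots,w_k\}\subseteq V(G)$, the representation of $v$ is $r(v\mid W)=(d_G(v,w_1),\ldots,d_G(v,w_k))$. $W$ is a resolving set of $G$ if $r(u\mid W)\neq r(v\mid W)$ for all distinct $u,v\in V(G)$. A diametral resolving set is a resolving set $W$ with $D(G)\subseteq W$; the diametral metric dimension $\dim_{\mathrm{diam}}(G)$ is the minimum cardinality of a diametral resolving set of $G$. Generalized corona: for a graph $G$ with $V(G)=\{v_1,\ldots,v_n\}$ and a sequence of graphs $\mathcal{H}=(H^1,\ldots,H^n)$, $G\odot\mathcal{H}$ is the graph obtained by taking one copy of $G$ and one (disjoint) copy of each $H^i$, and joining the vertex $v_i$ of $G$ to every vertex of the copy of $H^i$, for each $i=1,\ldots,n$.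
   Formalization: The formal theorem assumes n ≥ 2, excluding G = K_1, where the claim can fail: for H^1 the path a-b-c, the diametral set is {a,c} but b and v_1 have the same representation, so the dimension is 3, not 2. Each connected H^i is taken nonempty. *)

(* Defs.v *)
From mathcomp Require Import all_boot.

Set Implicit Arguments.
Unset Strict Implicit.
Unset Printing Implicit Defensive.

Record sgraph := SGraph {
  svertex :> finType;
  sedge : rel svertex;
  sedge_sym : symmetric sedge;
  sedge_irrefl : irreflexive sedge }.

Definition connected (G : sgraph) : Prop :=
  0 < #|G| /\ forall x y : G, connect (@sedge G) x y.

Definition complete_graph (G : sgraph) : Prop :=
  forall x y : G, sedge x y = (x != y).

Definition cycle_graph (G : sgraph) : Prop :=
  exists c : seq G,
    [/\ 2 < size c, uniq c, (forall x : G, x \in c) &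
        forall x y : G, sedge x y = (y == next c x) || (x == next c y)].

Section Metric.
Variable G : sgraph.
Implicit Types (u v w : G) (W : {set G}).

Definition has_path u v (k : nat) : bool :=
  [exists p : k.-tuple G,
     [&& path (@sedge G) u p, last u p == v & uniq (u :: p)]].

(* A path in G has length less than #|G|; when there is no u-v path, the value
   is the junk #|G|. *)
Definition dist u v : nat := find (has_path u v) (iota 0 #|G|).

Definition ecc v : nat := \max_(u : G) dist u v.

Definition diam : nat := \max_(v : G) ecc v.

Definition diametral_set : {set G} := [set v | ecc v == diam].

Definition representation v (W : seq G) : seq nat := [seq dist v w | w <- W].

(* Whether representations are distinct does not depend on how W is ordered. *)
Definition resolving W : bool :=
  injectiveb (fun v => representation v (enum W)).

Definition diametral_resolving W : bool :=
  resolving W && (diametral_set \subset W).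

(* The default value setT is admissible by diametral_resolvingT below. *)
Definition dim_diam : nat :=
  #|[arg min_(W < setT | diametral_resolving W) #|W|]|.

Lemma dist_eq0 u v : (dist u v == 0) = (u == v).
Proof.
rewrite /dist; have: 0 < #|G| by apply/card_gt0P; exists u.
case: #|G| => // m _ /=; case: ifPn => [/existsP[p]|].
  by rewrite (tuple0 p) /= => /andP[/eqP->]; rewrite !eqxx.
apply: contraNeq; rewrite negbK /= => /eqP ->.
by apply/existsP; exists [tuple]; rewrite /= eqxx.
Qed.

Lemma diametral_resolvingT : diametral_resolving setT.
Proof.
rewrite /diametral_resolving subsetT andbT; apply/injectiveP => u v.
move=> /eq_in_map/(_ u); rewrite mem_enum inE => /(_ isT) e.
by apply/esym/eqP; rewrite -dist_eq0 -e dist_eq0.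
Qed.

End Metric.

Section Corona.
Variables (n : nat) (G : sgraph) (v : 'I_n -> G) (H : 'I_n -> sgraph).

Definition corona_vertex : finType := (G + {i : 'I_n & H i})%type.

Definition corona_edge (a b : corona_vertex) : bool :=
  match a, b with
  | inl x, inl y => sedge x y
  | inl x, inr h => x == v (tag h)
  | inr h, inl x => x == v (tag h)
  | inr h, inr k => (tag h == tag k) && sedge (tagged h) (tagged_as h k)
  end.

Lemma corona_edge_sym : symmetric corona_edge.
Proof.
move=> [x|[i h]] [y|[j k]] //=; first exact: sedge_sym.
case: (eqVneq i j) k => [<- k|]; first by rewrite !tagged_asE sedge_sym.
by [].
Qed.

Lemma corona_edge_irrefl : irreflexive corona_edge.
Proof.
by case=> [x|[i h]] /=; rewrite ?eqxx ?tagged_asE sedge_irrefl.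
Qed.

Definition corona : sgraph := SGraph corona_edge_sym corona_edge_irrefl.

End Corona.

(* Main.v *)
Require Import Defs.
From mathcomp Require Import all_boot.
From mathcomp Require Import perm.

(** Cycles and complete graphs are connected and vertex-transitive, so every
    vertex of [G] has some other vertex at distance [diam G]. Two pendant
    vertices over distinct vertices [x], [y] of [G] are at distance
    [d x y + 2], hence every pendant vertex is diametral. The diametral set is
    then resolving: a vertex of it has distance [0] to itself only, and two
    vertices of [G] are separated by a pendant vertex over one of them. *)

Set Implicit Arguments.
Unset Strict Implicit.
Unset Printing Implicit Defensive.

(** * Shortest-path distance *)

Section Distance.
Variable G : sgraph.
Implicit Types (u v w : G) (p : seq G).

(** Repeated vertices can be cut out of a walk, and the resulting simple path has fewer than [#|G|]
    edges, so its length is among those that [find] inspects. *)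
Lemma dist_le_path u p : path (@sedge G) u p -> dist u (last u p) <= size p.
Proof.
move=> up; case/shortenP: (up) => q uq q_uniq q_sub.
have ltqG : size (u :: q) <= #|G| by rewrite -(card_uniqP q_uniq) max_card.
have /andP[_ /uniq_leq_size le_qp] := q_uniq.
apply: leq_trans (le_qp _ q_sub); rewrite leqNgt; apply/negP=> lt_q.
have := before_find 0 lt_q; rewrite nth_iota // add0n => /existsP[].
by exists (in_tuple q); rewrite /= uq eqxx.
Qed.

(** Connectedness makes the search succeed, which excludes the junk value [#|G|]. *)
Lemma dist_path u v : connect (@sedge G) u v ->
  exists p, [/\ path (@sedge G) u p, last u p = v & size p = dist u v].
Proof.
case/connectP=> p0 /shortenP[q uq q_uniq _] ->.
have ltqG : size (u :: q) <= #|G| by rewrite -(card_uniqP q_uniq) max_card.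
have hasq : has (has_path u (last u q)) (iota 0 #|G|).
  apply/hasP; exists (size q); first by rewrite mem_iota.
  by apply/existsP; exists (in_tuple q); rewrite /= uq eqxx.
have := hasq; rewrite has_find size_iota => lt_find.
have := nth_find 0 hasq; rewrite nth_iota // add0n.
case/existsP=> p /and3P[up /eqP lastp _].
by exists p; rewrite size_tuple.
Qed.

Lemma distxx u : dist u u = 0.
Proof. by apply/eqP; rewrite dist_eq0. Qed.

Lemma dist_le1 u v : sedge u v -> dist u v <= 1.
Proof. by move=> uv; apply: (@dist_le_path u [:: v]); rewrite /= uv. Qed.

Lemma dist_triangle u v w :
    connect (@sedge G) u v -> connect (@sedge G) v w ->
  dist u w <= dist u v + dist v w.
Proof.
case/dist_path=> p [up <- <-] /dist_path[q [vq <- <-]].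
by rewrite -last_cat -size_cat dist_le_path // cat_path up.
Qed.

(** The source of all lower bounds on distances below: a potential that rises by at most one per
    edge cannot outgrow the length of a walk. *)
Lemma dist_lipschitz (f : G -> nat) u v :
    (forall x y, sedge x y -> f y <= (f x).+1) -> connect (@sedge G) u v ->
  f v <= f u + dist u v.
Proof.
move=> f_lip /dist_path[p [up <- <-]].
elim: p u up => [|x p IHp] u /=; first by rewrite addn0.
case/andP=> /f_lip fux /IHp /leq_trans-> //.
by rewrite addnS -addSn leq_add2r.
Qed.

End Distance.

(** * Homomorphisms and vertex-transitivity *)

Lemma homo_connect (G K : sgraph) (f : G -> K) (x y : G) :
    {homo f : a b / sedge a b} -> connect (@sedge G) x y ->
  connect (@sedge K) (f x) (f y).
Proof.
move=> f_homo /connectP[p xp ->]; apply/connectP; exists (map f p).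
  exact: homo_path xp.
by rewrite last_map.
Qed.

Lemma homo_dist (G K : sgraph) (f : G -> K) (x y : G) :
    {homo f : a b / sedge a b} -> connect (@sedge G) x y ->
  dist (f x) (f y) <= dist x y.
Proof.
move=> f_homo /dist_path[p [xp <- <-]].
by rewrite -last_map -(size_map f) dist_le_path // (homo_path _ xp).
Qed.

(* An injective edge-preserving self-map of a finite graph is an automorphism. *)
Definition vertex_transitive (G : sgraph) : Prop :=
  forall x y : G, exists f : G -> G,
    [/\ injective f, {homo f : a b / sedge a b} & f x = y].

Lemma complete_vertex_transitive (G : sgraph) :
  complete_graph G -> vertex_transitive G.
Proof.
move=> complG x y; exists (tperm x y); split; [exact: perm_inj| |exact: tpermL].
by move=> a b; rewrite !complG (inj_eq perm_inj).
Qed.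

Lemma complete_connect (G : sgraph) (x y : G) :
  complete_graph G -> connect (@sedge G) x y.
Proof.
move=> complG; have [->|neq_xy] := eqVneq x y; first exact: connect0.
by rewrite connect1 // complG.
Qed.

(** Rotations do it: adjacency is expressed through [next c], which is injective, so iterating
    [next c] preserves edges, and some iterate sends [x] to [y]. *)
Lemma cycle_vertex_transitive (G : sgraph) :
  cycle_graph G -> vertex_transitive G.
Proof.
case=> c [_ c_uniq c_full c_edge] x y.
have next_inj : injective (next c) := can_inj (prev_next c_uniq).
have xy : fconnect (next c) x y.
  by rewrite (fconnect_cycle (cycle_next c_uniq)).
exists (iter (findex (next c) x y) (next c)); split; last exact: iter_findex.
  by elim: (findex _ _ _) => [|k IHk] a b //= /next_inj/IHk.
elim: (findex _ _ _) => [|k IHk] a b //= /IHk.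
by rewrite !c_edge !(inj_eq next_inj).
Qed.

Lemma cycle_connect (G : sgraph) (x y : G) :
  cycle_graph G -> connect (@sedge G) x y.
Proof.
case=> c [_ c_uniq c_full c_edge].
have : fconnect (next c) x y by rewrite (fconnect_cycle (cycle_next c_uniq)).
apply: connect_sub => a b /eqP <-.
by rewrite connect1 // c_edge eqxx.
Qed.

(** Take an edge-preserving bijection [f] with [f z = y] and let [t] be the preimage of [x]; since
    [f] does not increase distances, [t] is at least as far from [z] as [x] is from [y]. *)
Lemma vertex_transitive_dist (G : sgraph) (x y z : G) :
    vertex_transitive G -> (forall a b : G, connect (@sedge G) a b) ->
    x != y ->
  exists2 t, t != z & dist x y <= dist t z.
Proof.
move=> transG connG neq_xy; have [f [f_inj f_homo fz]] := transG z y.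
have [g _ gK] := injF_bij f_inj.
exists (g x); first by apply: contraNneq neq_xy => gxz; rewrite -fz -gxz gK.
by rewrite -{1}fz -{1}[x]gK homo_dist.
Qed.

(** * Distances in the corona *)

Section Corona.
Variables (n : nat) (G : sgraph) (v : 'I_n -> G) (H : 'I_n -> sgraph).
Hypothesis connG : forall x y : G, connect (@sedge G) x y.
Implicit Types (a b : corona v H) (x y : G).

Definition corona_root (a : corona v H) : G :=
  match a with inl x => x | inr h => v (tag h) end.

Local Notation core x := (inl x : corona v H).
Local Notation pendant h :=
  (inr (Tagged (fun j => H j : Type) h) : corona v H).

Lemma corona_root_connect a :
  connect (@sedge (corona v H)) a (core (corona_root a)).
Proof. by case: a => [x|h]; [exact: connect0 | rewrite connect1 //= eqxx]. Qed.

Lemma corona_root_dist a :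
  dist a (core (corona_root a)) <= 1 /\ dist (core (corona_root a)) a <= 1.
Proof.
by case: a => [x|h]; split; rewrite ?distxx //; apply: dist_le1; rewrite /= eqxx.
Qed.

Lemma corona_connect_sym : connect_sym (@sedge (corona v H)).
Proof. exact/sym_connect_sym/sedge_sym. Qed.

Lemma core_connect x y : connect (@sedge (corona v H)) (core x) (core y).
Proof. exact: homo_connect (connG x y). Qed.

Lemma corona_connect a b : connect (@sedge (corona v H)) a b.
Proof.
apply: connect_trans (corona_root_connect a) _.
apply: connect_trans (core_connect _ (corona_root b)) _.
by rewrite corona_connect_sym corona_root_connect.
Qed.

(** Go from [a] to its root, through the core, and from the root of [b] to [b]; the two outer legs
    cost at most one each. *)
Lemma corona_dist_le a b :
  dist a b <= dist (corona_root a) (corona_root b) + 2.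
Proof.
have [[le_a _] [_ le_b]] := (corona_root_dist a, corona_root_dist b).
have le_ab : dist (core (corona_root a)) (core (corona_root b)) <=
    dist (corona_root a) (corona_root b) by apply: homo_dist.
have := dist_triangle (corona_connect a (core (corona_root b)))
  (corona_connect _ b).
move/leq_trans; apply; rewrite -[2]/(1 + 1) addnA leq_add //.
have := dist_triangle (corona_connect a (core (corona_root a)))
  (corona_connect _ (core (corona_root b))).
by move/leq_trans; apply; rewrite addnC leq_add.
Qed.

Lemma dist_core_pendant_gt1 x i (h : H i) :
  x != v i -> 1 < dist (core x) (pendant h).
Proof.
(* The potential is 0 at [x], 1 on the rest of the core and on pendants over [x], and 2 on all other
   pendants. *)
move=> neq_xi; have := @dist_lipschitz _ (fun a => match a with
  | inl y => (y != x : nat) | inr k => if v (tag k) == x then 1 else 2 end)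
  (core x) (pendant h).
rewrite /= eqxx eq_sym (negPf neq_xi); apply; last exact: corona_connect.
move=> [y|k] [z|l] /=.
- by case: (z != x).
- by move/eqP->; case: (_ == x).
- by case: (z != x).
- by do 2!case: ifP.
Qed.

Lemma dist_pendant i j (h : H i) (k : H j) : i != j ->
  dist (v i) (v j) + 2 <= dist (pendant h) (pendant k).
Proof.
move=> neq_ij.
(* A potential modelled on the distance from the copy of [H i]: it vanishes on that whole copy, and
   any walk out of it first enters the core at [v i]. *)
pose f (a : corona v H) := match a with
  | inl y => (dist (v i) y).+1
  | inr l => if tag l == i then 0 else dist (v i) (v (tag l)) + 2 end.
have := @dist_lipschitz _ f (pendant h) (pendant k).
rewrite /= eqxx eq_sym (negPf neq_ij); apply; last exact: corona_connect.
move=> [y|l] [z|m] /=.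
- move=> yz; rewrite ltnS.
  apply: leq_trans (dist_triangle (connG _ y) (connG y z)) _.
  by rewrite -addn1 leq_add2l dist_le1.
- by move/eqP->; case: ifP; rewrite // addn2.
- move/eqP->; case: eqP => [->|_]; last by rewrite addn2 !ltnS ltnW.
  by rewrite ltnS leqn0 dist_eq0.
- by case/andP=> /eqP eq_lm _; rewrite eq_lm; case: ifP.
Qed.

(** An arbitrary distance [dist b a] is at most that of the roots plus 2. Transitivity moves the
    pair of roots to a pair ending at [v i], and a pendant over the other end attains the bound from
    [h]. *)
Lemma pendant_diametral i (h : H i) :
    1 < n -> bijective v -> vertex_transitive G -> (forall j, 0 < #|H j|) ->
  pendant h \in diametral_set (corona v H).
Proof.
move=> n_gt1 v_bij transG Hne; have [w vK wK] := v_bij.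
rewrite inE eqn_leq leq_bigmax; apply/bigmax_leqP=> a _; apply/bigmax_leqP=> b _.
have [t neq_t le_t] : exists2 t, t != v i &
    dist (corona_root b) (corona_root a) <= dist t (v i).
  (* With equal roots the core distance is 0, so any [t] other than [v i] serves; [1 < n] supplies
     one. *)
  have [->|] := eqVneq (corona_root b) (corona_root a).
    have /card_gt0P[j neq_ji] : 0 < #|predC1 i|.
      by rewrite cardC1 card_ord -ltnS prednK // ltnW.
    by exists (v j); rewrite ?distxx // (inj_eq (can_inj vK)).
  exact: vertex_transitive_dist.
have /card_gt0P[k _] := Hne (w t).
apply: leq_trans (leq_bigmax (pendant k)).
apply: leq_trans (dist_pendant k h _).
  by apply: leq_trans (corona_dist_le b a) _; rewrite leq_add2r wK.
by apply: contraNneq neq_t => <-; rewrite wK.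
Qed.

End Corona.

Theorem theorem3p5 (n : nat) (G : sgraph) (v : 'I_n -> G)
    (H : 'I_n -> sgraph) (n_gt1 : 1 < n) (v_bij : bijective v)
    (G_cycle_or_complete : cycle_graph G \/ complete_graph G)
    (H_connected : forall i : 'I_n, connected (H i)) :
  dim_diam (corona v H) = #|diametral_set (corona v H)|.
Proof.
have connG (x y : G) : connect (@sedge G) x y.
  by case: G_cycle_or_complete; [exact: cycle_connect | exact: complete_connect].
have transG : vertex_transitive G.
  case: G_cycle_or_complete.
    exact: cycle_vertex_transitive.
  exact: complete_vertex_transitive.
have Hne i : 0 < #|H i| by case: (H_connected i).
set D := diametral_set _.
have pendD i (h : H i) : inr (Tagged (fun j => H j : Type) h) \in D.
  exact: pendant_diametral.
have resolvD : diametral_resolving D.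
  rewrite /diametral_resolving subxx andbT; apply/injectiveP=> a b.
  move=> /eq_in_map eq_ab; have {}eq_ab c : c \in D -> dist a c = dist b c.
    by move=> Dc; apply: eq_ab; rewrite mem_enum.
  have eqD : (a \in D) || (b \in D) -> a = b.
    case/orP=> Dc; apply/eqP; last by rewrite -dist_eq0 (eq_ab _ Dc) distxx.
    by rewrite eq_sym -dist_eq0 -(eq_ab _ Dc) distxx.
  (* As soon as one of the two is a pendant, it lies in [D] and [eqD] applies. *)
  case: a b eq_ab eqD => [x|[i h]] [y|[j k]] eq_ab eqD; last 3 first.
  - by apply: eqD; rewrite pendD orbT.
  - by apply: eqD; rewrite pendD.
  - by apply: eqD; rewrite pendD.
  (* For two core vertices, a pendant over [y] is adjacent to [y] but at distance at least 2 from
     any other [x]. *)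
  have [w _ wK] := v_bij; have /card_gt0P[h _] := Hne (w y).
  apply/eqP; apply: contraT => neq_xy.
  have := @dist_core_pendant_gt1 _ _ v H connG x (w y) h.
  rewrite wK => /(_ neq_xy).
  by rewrite (eq_ab _ (pendD _ h)) ltnNge dist_le1 //= wK.
(* The minimiser [W] contains [D] by admissibility and is no larger than [D], which is itself
   admissible. *)
rewrite /dim_diam; case: arg_minnP => [|W /andP[_ sDW] minW].
  exact: diametral_resolvingT.
by apply/eqP; rewrite eqn_leq minW // subset_leq_card.
Qed.
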